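(* Let $\mathcal{X},\mathcal{Y}$ be Polish spaces and suppose a risk form $\rho:\mathbb{B}(\mathcal{X}\times\mathcal{Y})\times\mathcal{P}(\mathcal{X}\times\mathcal{Y})\to\mathbb{R}$ is monotonic, normalized, translation equivariant, has the support property, and is conditionally consistent. Then a risk form $\rho_{\mathcal{X}}:\mathbb{B}(\mathcal{X})\times\mathcal{P}(\mathcal{X})\to\mathbb{R}$ exists, such that for all $[Z,P]\in\mathbb{B}(\mathcal{X}\times\mathcal{Y})\times\mathcal{P}(\mathcal{X}\times\mathcal{Y})$ $$\rho[Z,P]=\rho_{\mathcal{X}}\big[\rho_{\mathcal{Y}|\mathcal{X}}[Z,P_{\mathcal{Y}|\mathcal{X}}],P_{\mathcal{X}}\big].$$ The risk form $\rho_{\mathcal{X}}$ is uniquely defined by the equation $$\rho_{\mathcal{X}}[f,P_{\mathcal{X}}]=\rho[\underline{f},P],\quad\text{with}\quad\underline{f}(x,y)\equiv f(x)$$ (for $f\in\mathbb{B}(\mathcal{X})$ and $P\in\mathcal{P}(\mathcal{X}\times\mathcal{Y})$ with marginal $P_{\mathcal{X}}$). It is monotonic, normalized, translation equivariant, and has the support property.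
   Context: All Polish spaces carry their Borel $\sigma$-algebras. For a Polish space $\mathcal{S}$, $\mathcal{P}(\mathcal{S})$ is the set of Borel probability measures on $\mathcal{S}$ and $\mathbb{B}(\mathcal{S})$ is the space of real-valued bounded Borel measurable functions on $\mathcal{S}$; $\mathbf{1}$ is the constant function $1$, $\mathbf{1}_A$ the indicator of $A$; inequalities between functions are pointwise. A risk form on $\mathcal{S}$ is a measurable functional $\rho:\mathbb{B}(\mathcal{S})\times\mathcal{P}(\mathcal{S})\to\mathbb{R}$. It is: - monotonic if $V\le W$ implies $\rho[V,P]\le\rho[W,P]$ for all $P$; - normalized if $\rho[0,P]=0$ for all $P$; - translation equivariant if $\rho[a\mathbf{1}+V,P]=a+\rho[V,P]$ for all $V\in\mathbb{B}(\mathcal{S})$, $a\in\mathbb{R}$, $P\in\mathcal{P}(\mathcal{S})$. It has the support property if $\rho[\mathbf{1}_{\operatorname{supp}(P)}V,P]=\rho[V,P]$ for all $V,P$. Every $P\in\mathcal{P}(\mathcal{X}\times\mathcal{Y})$ is disintegrated into its marginal $P_{\mathcal{X}}\in\mathcal{P}(\mathcal{X})$ and a transition kernel $P_{\mathcal{Y}|\mathcal{X}}:\mathcal{X}\to\mathcal{P}(\mathcal{Y})$, i.e. $P(dx,dy)=P_{\mathcal{X}}(dx)\,P_{\mathcal{Y}|\mathcal{X}}(dy|x)$. $\mathcal{Q}(\mathcal{Y}|\mathcal{X})$ is the space of all measurable mappings (transition kernels) $Q:\mathcal{X}\to\mathcal{P}(\mathcal{Y})$. For $\lambda\in\mathcal{P}(\mathcal{X})$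 and $Q\in\mathcal{Q}(\mathcal{Y}|\mathcal{X})$, $\lambda\otimes Q\in\mathcal{P}(\mathcal{X}\times\mathcal{Y})$ is $[\lambda\otimes Q](dx,dy)=\lambda(dx)\,Q(dy|x)$. For a monotonic, normalized, translation equivariant risk form $\rho$ on $\mathcal{X}\times\mathcal{Y}$, the conditional risk operator $\rho_{\mathcal{Y}|\mathcal{X}}:\mathbb{B}(\mathcal{X}\times\mathcal{Y})\times\mathcal{Q}(\mathcal{Y}|\mathcal{X})\to\mathbb{B}(\mathcal{X})$ is $\rho_{\mathcal{Y}|\mathcal{X}}[Z,Q](x)=\rho[Z,\delta_x\otimes Q]$, $x\in\mathcal{X}$. $\rho$ is conditionally consistent if for all $Z,Z'\in\mathbb{B}(\mathcal{X}\times\mathcal{Y})$ and all $Q,Q'\in\mathcal{Q}(\mathcal{Y}|\mathcal{X})$ with $\rho_{\mathcal{Y}|\mathcal{X}}[Z,Q]\le\rho_{\mathcal{Y}|\mathcal{X}}[Z',Q']$ one has $\rho[Z,\lambda\otimes Q]\le\rho[Z',\lambda\otimes Q']$ for all $\lambda\in\mathcal{P}(\mathcal{X})$. *)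

(* Defs.v *)
From HB Require Import structures.
From mathcomp Require Import all_boot all_order all_algebra.
From mathcomp Require Import all_classical all_reals all_analysis.
From mathcomp Require Import measurable_realfun.

Set Implicit Arguments.
Unset Strict Implicit.
Unset Printing Implicit Defensive.

Import Order.TTheory GRing.Theory Num.Theory.
Import numFieldNormedType.Exports.

Local Open Scope classical_set_scope.
Local Open Scope ring_scope.

Definition complete_metric_for (R : realType) (T : topologicalType)
    (dist : T -> T -> R) : Prop :=
  [/\ forall x y, dist x y = 0 <-> x = y,
      forall x y, dist x y = dist y x,
      forall x y z, dist x z <= dist x y + dist y z,
      forall x, nbhs x = nbhs_ball_ (fun a e => [set b | dist a b < e]) x &
      forall u : nat -> T,
        (forall e, 0 < e -> exists N, forall m n, (N <= m)%N -> (N <= n)%N ->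
          dist (u m) (u n) < e) ->
        exists l : T, u @ \oo --> l].

(* The metric is existential, so that only the topology and its Borel sets are
   part of the structure. Measurable types are pointed, hence a polishType is
   nonempty. On X * Y the sigma-algebra is the product one; the instance below
   shows that it is the Borel sigma-algebra of the product topology. *)
HB.mixin Record isPolish (R : realType) d T
    of Topological T & Measurable d T := {
  polish_borel : (@measurable d T : set (set T)) = <<s @open T >> ;
  polish_separable : exists2 D : set T, countable D & dense D ;
  polish_metrizable : exists dist : T -> T -> R, complete_metric_for dist
}.

#[short(type="polishType")]
HB.structure Definition Polish (R : realType) d :=
  {T of Topological T & Measurable d T & isPolish R d T}.

Section polish_theory.
Context (R : realType) d (T : polishType R d).

Lemma polish_open_measurable (U : set T) : open U -> measurable U.
Proof. by move=> oU; rewrite (@polish_borel R d T); exact: sub_sigma_algebra. Qed.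

Lemma polish_closed_measurable (C : set T) : closed C -> measurable C.
Proof.
by move=> cC; rewrite -(setCK C); apply: measurableC;
  apply: polish_open_measurable; rewrite openC.
Qed.

Lemma polish_second_countable : @second_countable T.
Proof.
have [D cD dD] := @polish_separable R d T.
have [dist [d0 ds dt dn _]] := @polish_metrizable R d T.
pose B (x : T) (e : R) : set T := [set y | dist x y < e].
have oB x e : open (B x e).
  rewrite openE => y /= xy; rewrite /interior dn.
  exists (e - dist x y); first by rewrite /= subr_gt0.
  move=> z /= yz; rewrite /B/=; apply: le_lt_trans (dt _ y _) _.
  by rewrite -ltrBrDl.
exists [set B x n.+1%:R^-1 | x in D & n in [set: nat]].
  have -> : [set B x n.+1%:R^-1 | x in D & n in [set: nat]] =
      (fun p => B p.1 p.2.+1%:R^-1) @` (D `*` [set: nat]).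
    apply/seteqP; split => [_ [x Dx [n _ <-]]|_ [[x n] /= [Dx _] <-]].
      by exists (x, n).
    by exists x => //; exists n.
  by apply: card_le_trans (card_image_le _ _) _; exact: countableX.
split; first by move=> _ [x Dx [n _ <-]]; exact: oB.
move=> x A; rewrite /= dn => -[e /= e0 eA].
have [n ne] : exists n, (n.+1%:R^-1 : R) < e / 2.
  have e2 : 0 < e / 2 by rewrite divr_gt0.
  exists (Num.truncn (e / 2)^-1).
  by rewrite -[ltRHS]invrK ltf_pV2 ?posrE ?invr_gt0//; exact: truncnS_gt.
have [y [/= xy Dy]] : B x n.+1%:R^-1 `&` D !=set0.
  apply: dD => //; exists x; rewrite /B /= (d0 x x).2//.
exists (B y n.+1%:R^-1).
  split; first by exists y => //; exists n.
  by rewrite /B/= ds.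
move=> z yz; apply: eA; apply: le_lt_trans (dt _ y _) _.
by rewrite (splitr e) ltrD//; [apply: lt_trans xy _|apply: lt_trans yz _].
Qed.

End polish_theory.

Section polish_prod.
Context (R : realType) d d' (X : polishType R d) (Y : polishType R d').

Let prod_borel :
  (@measurable _ (X * Y)%type : set (set (X * Y))) = <<s @open (X * Y)%type >>.
Proof.
apply/seteqP; split.
- have mf : @measurable_fun _ _ (g_sigma_algebraType (@open (X * Y)%type)) X setT fst.
    apply: (@measurability _ _ (g_sigma_algebraType (@open (X * Y)%type)) X setT
      fst (@open X)) => //; first exact: polish_borel.
    move=> _ [A oA <-]; rewrite setTI; apply: sub_sigma_algebra.
    by apply: open_comp => // x _; exact: cvg_fst.
  have ms : @measurable_fun _ _ (g_sigma_algebraType (@open (X * Y)%type)) Y setT snd.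
    apply: (@measurability _ _ (g_sigma_algebraType (@open (X * Y)%type)) Y setT
      snd (@open Y)) => //; first exact: polish_borel.
    move=> _ [A oA <-]; rewrite setTI; apply: sub_sigma_algebra.
    by apply: open_comp => // x _; exact: cvg_snd.
  rewrite measurable_prod_measurableType.
  apply: smallest_sub; first exact: smallest_sigma_algebra.
  move=> _ [A mA [B mB <-]].
  have -> : A `*` B = ([set: X * Y] `&` fst @^-1` A) `&` ([set: X * Y] `&` snd @^-1` B).
    by rewrite !setTI.
  apply: (@measurableI _ (g_sigma_algebraType (@open (X * Y)%type))).
    exact: mf.
  exact: ms.
- apply: smallest_sub; first exact: sigma_algebra_measurable.
  move=> O oO.
  have [BX cBX [oBX bX]] := @polish_second_countable R d X.
  have [BY cBY [oBY bY]] := @polish_second_countable R d' Y.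
  pose I := [set p | [/\ BX p.1, BY p.2 & p.1 `*` p.2 `<=` O]].
  have /countable_injP[f injf] : countable I.
    apply: sub_countable (countableX cBX cBY).
    by apply: subset_card_le => p [].
  have -> : O = \bigcup_n \bigcup_(p in [set p | I p /\ f p = n]) (p.1 `*` p.2).
    apply/seteqP; split => [[x y] Oxy|z [n _ [p [[_ _ pO] _] /pO//]]].
    move: oO; rewrite openE => /(_ _ Oxy) [[P Q] /=
      [/bX [U [BU Ux] UP] /bY [V [BV Vy] VQ]] PQ].
    exists (f (U, V)) => //; exists (U, V) => //=; split => //; split => // z [z1 z2].
    by apply: PQ; split; [exact: UP|exact: VQ].
  apply: bigcupT_measurable => n.
  have [[p [Ip fp]]|np] := pselect (exists p, I p /\ f p = n).
    rewrite (_ : [set p | I p /\ f p = n] = [set p]); last first.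
      apply/seteqP; split => [q [Iq fq]|_ ->//].
      by apply: injf; rewrite ?inE// fp fq.
    rewrite bigcup_set1; case: Ip => p1 p2 _.
    by apply: measurableX; apply: polish_open_measurable; [exact: oBX|exact: oBY].
  rewrite bigcup0// => p [Ip fp]; exfalso; apply: np; by exists p.
Qed.

Let prod_separable : exists2 D : set (X * Y), countable D & dense D.
Proof.
have [D cD dD] := @polish_separable R d X.
have [E cE dE] := @polish_separable R d' Y.
exists (D `*` E); first exact: countableX.
move=> O [[x y] Oxy] oO; move: (oO); rewrite openE.
move=> /(_ _ Oxy) [[P Q] /= []].
rewrite nbhsE => -[U [oU Ux] UP]; rewrite nbhsE => -[V [oV Vy] VQ] PQ.
have [x' [Ux' Dx']] := dD U (ex_intro _ _ Ux) oU.
have [y' [Vy' Ey']] := dE V (ex_intro _ _ Vy) oV.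
exists (x', y'); split; last by split.
by apply: PQ; split => /=; [exact: UP|exact: VQ].
Qed.

Let prod_metrizable :
  exists dist : X * Y -> X * Y -> R, complete_metric_for dist.
Proof.
have [dx [dx0 dxs dxt dxn dxc]] := @polish_metrizable R d X.
have [dy [dy0 dys dyt dyn dyc]] := @polish_metrizable R d' Y.
have dx_ge0 x x' : 0 <= dx x x'.
  rewrite -(@pmulrn_lge0 _ _ 2)// mulr2n {2}dxs -((dx0 x x).2 erefl).
  exact: dxt.
have dy_ge0 x x' : 0 <= dy x x'.
  rewrite -(@pmulrn_lge0 _ _ 2)// mulr2n {2}dys -((dy0 x x).2 erefl).
  exact: dyt.
exists (fun p q => Num.max (dx p.1 q.1) (dy p.2 q.2)); split.
- move=> [x y] [x' y'] /=; split => [m0|[-> ->]]; last first.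
    by rewrite (dx0 _ _).2// (dy0 _ _).2// maxxx.
  congr (_, _).
    by apply/dx0/le_anti; rewrite dx_ge0 -m0 le_max lexx.
  by apply/dy0/le_anti; rewrite dy_ge0 -m0 le_max lexx orbT.
- by move=> p q; rewrite dxs dys.
- move=> p q r; rewrite ge_max; apply/andP; split.
    by apply: le_trans (dxt _ q.1 _) _; apply: lerD; rewrite le_max lexx.
  by apply: le_trans (dyt _ q.2 _) _; apply: lerD; rewrite le_max lexx orbT.
- move=> [x y]; apply/seteqP; split => A.
    move=> [[P Q] /= []]; rewrite dxn dyn.
    move=> [e /= e0 eP] [e' /= e'0 eQ] PQ.
    exists (Num.min e e'); first by rewrite /= lt_min e0.
    move=> [x' y'] /=; rewrite gt_max !lt_min => /andP[/andP[h1 _] /andP[_ h2]].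
    by apply: PQ; split; [exact: eP|exact: eQ].
  move=> [e /= e0 eA].
  exists ([set x' | dx x x' < e], [set y' | dy y y' < e]) => /=.
    by rewrite dxn dyn; split; exists e.
  by move=> [x' y'] [/= h1 h2]; apply: eA; rewrite /= gt_max h1.
- move=> u cu.
  have [|l1 ul1] := dxc (fst \o u).
    move=> e /cu[N uN]; exists N => m n Nm Nn.
    by have := uN _ _ Nm Nn; rewrite gt_max => /andP[].
  have [|l2 ul2] := dyc (snd \o u).
    move=> e /cu[N uN]; exists N => m n Nm Nn.
    by have := uN _ _ Nm Nn; rewrite gt_max => /andP[].
  exists (l1, l2); have uE : u = (fun n => ((fst \o u) n, (snd \o u) n)).
    by apply: funext => n /=; case: (u n).
  by rewrite uE; exact: (cvg_pair ul1 ul2).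
Qed.

HB.instance Definition _ := @isPolish.Build R _ (X * Y)%type
  prod_borel prod_separable prod_metrizable.

End polish_prod.

Section bmfun.
Context (R : realType) d (S : polishType R d).

Record bmfun := BMFun {
  bmfun_val :> S -> R ;
  bmfun_measurable : measurable_fun setT bmfun_val ;
  bmfun_bounded : exists M : R, forall x, `|bmfun_val x| <= M
}.

HB.instance Definition _ := gen_eqMixin bmfun.
HB.instance Definition _ := gen_choiceMixin bmfun.

Lemma bmfunP (V W : bmfun) : V =1 W -> V = W.
Proof.
case: V W => V mV bV [W mW bW] /= /funext VW.
by rewrite VW in mV bV *; congr BMFun; exact: Prop_irrelevance.
Qed.

Lemma bm_cst_measurable (a : R) : measurable_fun setT (fun _ : S => a).
Proof. exact: measurable_cst. Qed.

Lemma bm_cst_bounded (a : R) : exists M : R, forall x : S, `|a| <= M.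
Proof. by exists `|a|. Qed.

Definition bm_cst (a : R) : bmfun :=
  BMFun (bm_cst_measurable a) (bm_cst_bounded a).

HB.instance Definition _ := isPointed.Build bmfun (bm_cst 0).

Lemma bm_add_measurable (V W : bmfun) : measurable_fun setT (fun x => V x + W x).
Proof. by apply: measurable_funD; exact: bmfun_measurable. Qed.

Lemma bm_add_bounded (V W : bmfun) : exists M : R, forall x, `|V x + W x| <= M.
Proof.
have [M VM] := bmfun_bounded V; have [N WN] := bmfun_bounded W.
by exists (M + N) => x; apply: le_trans (ler_normD _ _) _; exact: lerD.
Qed.

Definition bm_add (V W : bmfun) : bmfun :=
  BMFun (bm_add_measurable V W) (bm_add_bounded V W).

Lemma bm_mul_measurable (V W : bmfun) : measurable_fun setT (fun x => V x * W x).
Proof. by apply: measurable_funM; exact: bmfun_measurable. Qed.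

Lemma bm_mul_bounded (V W : bmfun) : exists M : R, forall x, `|V x * W x| <= M.
Proof.
have [M VM] := bmfun_bounded V; have [N WN] := bmfun_bounded W.
by exists (M * N) => x; rewrite normrM ler_pM.
Qed.

Definition bm_mul (V W : bmfun) : bmfun :=
  BMFun (bm_mul_measurable V W) (bm_mul_bounded V W).

Lemma bm_indic_bounded (A : set S) : exists M : R, forall x, `|\1_A x : R| <= M.
Proof.
by exists 1 => x; rewrite indicE; case: (_ \in _); rewrite ?normr1 ?normr0.
Qed.

Definition bm_indic (A : set S) (mA : measurable A) : bmfun :=
  BMFun (measurable_indic mA) (bm_indic_bounded A).

(* open sets of the supremum norm *)
Definition sup_open : set (set bmfun) :=
  [set U : set bmfun | forall V : bmfun, U V ->
    exists2 e : R, 0 < e & forall W : bmfun, (forall x, `|W x - V x| < e) -> U W].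

Definition supp (P : probability S R) : set S :=
  \bigcap_(C in [set C : set S | closed C /\ P C = 1%E]) C.

Lemma measurable_supp (P : probability S R) : measurable (supp P).
Proof.
by apply: polish_closed_measurable; apply: closed_bigI => C [].
Qed.

Definition bm_restrict_supp (P : probability S R) (V : bmfun) : bmfun :=
  bm_mul (bm_indic (measurable_supp P)) V.

End bmfun.
Arguments bmfun {R d} S.
Arguments bm_cst {R d} S a.
Arguments sup_open {R d} S.

Section risk_form.
Context (R : realType) d (S : polishType R d).
Implicit Types (rho : bmfun S -> probability S R -> R).

(* Measurability of rho is understood separately in each argument, for the
   Borel sets of the supremum norm on bmfun S and the Borel sets of weak
   convergence on probability measures (generated by the evaluations
   P |-> P A, as in pprobability).
   Measurability for a product sigma-algebra would be too strong: if rho is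
   normalized, translation equivariant and has the support property, then
   rho (1_A) (dirac x) = 1_A x, and the relation "x is in A", A ranging over
   all Borel sets, is in no product sigma-algebra when S is uncountable because
   the sections of a set of such a sigma-algebra have bounded Borel rank.
   A term of type probability S R is a function on all subsets of S;
   measurability also forces rho V P to depend only on the values of P on
   measurable sets. *)
Definition risk_form rho : Prop :=
  (forall V : bmfun S,
    measurable_fun [set: pprobability S R] (fun P => rho V P)) /\
  (forall P : probability S R,
    measurable_fun [set: g_sigma_algebraType (sup_open S)] (fun V => rho V P)).

Definition monotonic rho : Prop :=
  forall (V W : bmfun S) (P : probability S R),
    (forall x, V x <= W x) -> rho V P <= rho W P.

Definition normalized rho : Prop :=
  forall P : probability S R, rho (bm_cst S 0) P = 0.

Definition translation_equivariant rho : Prop :=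
  forall (V : bmfun S) (a : R) (P : probability S R),
    rho (bm_add (bm_cst S a) V) P = a + rho V P.

Definition support_property rho : Prop :=
  forall (V : bmfun S) (P : probability S R),
    rho (bm_restrict_supp P V) P = rho V P.

End risk_form.

Section tensor.
Local Open Scope ereal_scope.
Context (R : realType) d d' (X : measurableType d) (Y : measurableType d').
Variables (lam : probability X R) (Q : R.-pker X ~> Y).

Definition tensor (A : set (X * Y)) : \bar R := \int[lam]_x Q x (xsection A x).

Let tensor0 : tensor set0 = 0.
Proof. by apply: integral0_eq => x _; rewrite xsection0 measure0. Qed.

Let tensor_ge0 A : 0 <= tensor A.
Proof. by apply: integral_ge0 => x _. Qed.

Let tensor_sigma_additive : semi_sigma_additive tensor.
Proof.
move=> F mF tF mUF.
have -> : tensor (\bigcup_n F n) = \sum_(n <oo) tensor (F n).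
  rewrite /tensor -integral_nneseries//; last first.
    by move=> n; apply: measurable_fun_xsection_finite_kernel; rewrite inE.
  apply: eq_integral => x _; rewrite xsection_bigcup measure_bigcup//=.
  - by apply: eq_eseriesl => i; rewrite in_setT.
  - by move=> n _; exact: measurable_xsection.
  - exact: trivIset_xsection.
by apply: is_cvg_nneseries => n _ _.
Qed.

HB.instance Definition _ := isMeasure.Build _ (X * Y)%type R tensor
  tensor0 tensor_ge0 tensor_sigma_additive.

Let tensorT : tensor [set: X * Y] = 1.
Proof.
rewrite /tensor (eq_integral (cst 1)) => [|x _].
  by rewrite integral_cst//= mul1e probability_setT.
by rewrite xsectionE preimage_setT prob_kernel.
Qed.

HB.instance Definition _ :=
  Measure_isProbability.Build _ (X * Y)%type R tensor tensorT.

End tensor.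

Section conditional_risk.
Context (R : realType) d d' (X : polishType R d) (Y : polishType R d').
Implicit Types (rho : bmfun (X * Y)%type -> probability (X * Y)%type R -> R).

Definition dirac_tensor (x : X) (Q : R.-pker X ~> Y) :
  probability (X * Y)%type R := tensor (dirac x) Q.

Definition conditional_risk rho (Z : bmfun (X * Y)%type) (Q : R.-pker X ~> Y) :
  X -> R := fun x => rho Z (dirac_tensor x Q).

Lemma dirac_tensorE x Q (A : set (X * Y)) : measurable A ->
  dirac_tensor x Q A = Q x (xsection A x).
Proof.
move=> mA; rewrite /dirac_tensor/= /tensor integral_dirac//.
  by rewrite diracT mul1e.
by apply: measurable_fun_xsection_finite_kernel; rewrite inE.
Qed.

Lemma measurable_dirac_tensor (Q : R.-pker X ~> Y) :
  measurable_fun [set: X]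
    (fun x => dirac_tensor x Q : pprobability (X * Y)%type R).
Proof.
apply: (measurability (@pset _ _ _ : set (set (pprobability (X * Y)%type R)))) => //.
move=> _ [_ [r _ [A mA <-]] <-].
rewrite setTI /mset/= (_ : _ @^-1` _ = (fun x => Q x (xsection A x)) @^-1` `]-oo, r%:E[%classic); last first.
  by apply/seteqP; split => x /=; rewrite dirac_tensorE// in_itv.
rewrite -[X in measurable X]setTI.
have mQ : measurable_fun setT (fun x => Q x (xsection A x)).
  by apply: measurable_fun_xsection_finite_kernel; rewrite inE.
by apply: mQ => //; exact: emeasurable_itv.
Qed.

Lemma conditional_risk_measurable rho Z Q : risk_form rho ->
  measurable_fun setT (conditional_risk rho Z Q).
Proof.
move=> [mrho _].
exact: (measurableT_comp (mrho Z) (measurable_dirac_tensor Q)).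
Qed.

Lemma conditional_risk_bounded rho Z Q : monotonic rho -> normalized rho ->
  translation_equivariant rho ->
  exists M : R, forall x, `|conditional_risk rho Z Q x| <= M.
Proof.
move=> mon nor tra; have [M ZM] := bmfun_bounded Z.
have rho_cst a P : rho (bm_cst _ a) P = a.
  rewrite -[RHS]addr0 -(nor P) -tra; congr (rho _ P).
  by apply: bmfunP => x /=; rewrite addr0.
exists M => x; rewrite ler_norml -[in X in X && _](rho_cst (- M) (dirac_tensor x Q)).
rewrite -[in X in _ && X](rho_cst M (dirac_tensor x Q)) /conditional_risk.
by apply/andP; split; apply: mon => z /=; move: (ZM z); rewrite ler_norml => /andP[].
Qed.

Definition conditional_risk_operator rho (frho : risk_form rho)
    (mrho : monotonic rho) (nrho : normalized rho)
    (trho : translation_equivariant rho)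
    (Z : bmfun (X * Y)%type) (Q : R.-pker X ~> Y) : bmfun X :=
  BMFun (conditional_risk_measurable Z Q frho)
        (conditional_risk_bounded Z Q mrho nrho trho).

Definition conditionally_consistent rho : Prop :=
  forall (Z Z' : bmfun (X * Y)%type) (Q Q' : R.-pker X ~> Y),
    (forall x, conditional_risk rho Z Q x <= conditional_risk rho Z' Q' x) ->
    forall lam : probability X R, rho Z (tensor lam Q) <= rho Z' (tensor lam Q').

Lemma bm_lift_measurable (f : bmfun X) :
  measurable_fun setT (fun z : X * Y => f z.1).
Proof. exact: (measurableT_comp (bmfun_measurable f) measurable_fst). Qed.

Lemma bm_lift_bounded (f : bmfun X) :
  exists M : R, forall z : X * Y, `|f z.1| <= M.
Proof. by have [M fM] := bmfun_bounded f; exists M => z. Qed.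

Definition bm_lift (f : bmfun X) : bmfun (X * Y)%type :=
  BMFun (bm_lift_measurable f) (bm_lift_bounded f).

Definition fst_mfun : {mfun (X * Y)%type >-> X} :=
  HB.pack fst (isMeasurableFun.Build _ _ _ _ fst (@measurable_fst _ _ X Y)).

Definition marginal (P : probability (X * Y)%type R) : probability X R :=
  distribution P fst_mfun.

(* Q is a version of the conditional distribution of the second coordinate *)
Definition disintegrates (P : probability (X * Y)%type R)
    (Q : R.-pker X ~> Y) : Prop :=
  forall A : set (X * Y), measurable A -> P A = tensor (marginal P) Q A.

Definition disintegration_formula rho (frho : risk_form rho)
    (mrho : monotonic rho) (nrho : normalized rho)
    (trho : translation_equivariant rho)
    (rhoX : bmfun X -> probability X R -> R) : Prop :=
  forall (Z : bmfun (X * Y)%type) (P : probability (X * Y)%type R)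
    (Q : R.-pker X ~> Y), disintegrates P Q ->
    rho Z P =
    rhoX (conditional_risk_operator frho mrho nrho trho Z Q) (marginal P).

Definition marginal_formula rho (rhoX : bmfun X -> probability X R -> R) : Prop :=
  forall (f : bmfun X) (P : probability (X * Y)%type R),
    rhoX f (marginal P) = rho (bm_lift f) P.

End conditional_risk.

(* Main.v *)
Require Import Defs.
From HB Require Import structures.
From mathcomp Require Import all_boot all_order all_algebra.
From mathcomp Require Import all_classical all_reals all_analysis.
From mathcomp Require Import measurable_realfun lra.

Set Implicit Arguments.
Unset Strict Implicit.
Unset Printing Implicit Defensive.

Import Order.TTheory GRing.Theory Num.Theory.
Import numFieldNormedType.Exports.

Local Open Scope classical_set_scope.
Local Open Scope ring_scope.

(** The candidate for the marginal risk form is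
    rhoX[f, lam] = rho[f o fst, lam (x) Q0], with Q0 the constant kernel at some
    fixed point of Y.  The support property gives rho[f o fst, delta_x (x) Q] =
    f(x) for every kernel Q ([conditional_risk_lift]): the support of
    delta_x (x) Q lies in the closed set {x} * Y, on which f o fst is constant.
    Hence, if f is the conditional risk of (Z, Q), then (Z, Q) and (f o fst, Q0)
    have the same conditional risk, and conditional consistency, used in both
    directions, gives rho[Z, lam (x) Q] = rhoX[f, lam] ([risk_disintegrated]).
    This is the disintegration formula.

    Conversely, let rhoX satisfy the disintegration formula.  Applying it to f o fst
    and to a disintegration of P gives the marginal formula rhoX[f, P_X] =
    rho[f o fst, P], and the remaining properties of rhoX are read off from those
    of rho.  This step needs every P on X * Y to have a disintegration
    ([disintegration_exists]), which is proved as follows.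
    - A Polish space Y is a measurable retract of the real line
      ([polish_coding]): a point is coded by the base-3 expansion whose digits say
      in which balls around a countable dense set it lies, and decoded as the
      limit of the centres.  So it is enough to disintegrate the law of (x, s(y))
      with s real-valued.
    - For each rational q the measure D |-> P(D * {s < q}) has a density f_q
      with respect to the marginal ([conditional_density_exists]), and the supremum
      of the densities of a chain of sets is a density of their union
      ([conditional_density_bigcup]).
    - If u is uniform on [0, 1] then G(x, u) = inf {q | u < f_q(x)} has the
      required conditional law ([disintegration_real]): G(x, u) < r means
      u < sup_(q < r) f_q(x), an event whose probability is that supremum.

    Throughout, two probabilities that agree on measurable sets need not be equal
    as functions on all sets; a risk form does not distinguish them
    ([risk_form_eq_measurable]). *)

(** * Risk forms and supports *)

(** A generated sigma-algebra separates no more points than its generators. *)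
Lemma sigma_algebra_indistinguishable (T : Type) (G : set (set T)) (x y : T) :
  (forall A, G A -> A x <-> A y) -> forall A, <<s G >> A -> A x <-> A y.
Proof.
move=> Gxy; apply: smallest_sub => //; split => //=.
- by move=> A Axy; split => -[_ nA]; split => // /Axy.
- by move=> F Fxy; split => -[n _ /Fxy Fn]; exists n.
Qed.

(** The preimage of [rho V P] belongs to the sigma-algebra generated by the
    evaluations on measurable sets, which do not separate [P] from [P']. *)
Lemma risk_form_eq_measurable (R : realType) d (S : polishType R d)
    (rho : bmfun S -> probability S R -> R) (V : bmfun S)
    (P P' : probability S R) :
  risk_form rho -> (forall A, measurable A -> P A = P' A) ->
  rho V P = rho V P'.
Proof.
move=> [/(_ V) mrho _] PP'.
have mU := mrho measurableT [set rho V P] (measurable_set1 _).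
rewrite setTI in mU.
suff: [set rho V P] (rho V P) <-> [set rho V P] (rho V P').
  by move=> [/(_ erefl)].
apply: (sigma_algebra_indistinguishable _ mU).
by move=> _ [r _ [A mA <-]]; rewrite /mset/= PP'.
Qed.

Section support.
Context (R : realType) d (S : polishType R d).

Lemma polish_closed_set1 (x : S) : closed [set x].
Proof.
have [dist [d0 ds dt dn _]] := @polish_metrizable R d S.
rewrite -openC openE => y /= yx; rewrite /interior dn.
have dxy : 0 < dist x y.
  have d_ge0 : 0 <= dist x y.
    rewrite -(@pmulrn_lge0 _ _ 2)// mulr2n {2}ds -((d0 x x).2 erefl).
    exact: dt.
  by rewrite lt_neqAle d_ge0 andbT eq_sym; apply/eqP => /d0 /esym.
exists (dist x y) => //= z /= yz zx; move: yz.
by rewrite zx ds ltxx.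
Qed.

Lemma supp_sub (P : probability S R) (C : set S) :
  closed C -> P C = 1%E -> supp P `<=` C.
Proof. by move=> cC PC x; apply. Qed.

(** The complement of the support is covered by the countably many null members of
    a countable base. *)
Lemma prob_supp (P : probability S R) : P (supp P) = 1%E.
Proof.
have [B cB [oB nB]] := @polish_second_countable R d S.
pose B0 := [set U | B U /\ P U = 0%E].
have cB0 : countable B0 by apply: sub_countable cB; apply: subset_card_le => U [].
have suppE : ~` supp P = \bigcup_(U in B0) U.
  apply/seteqP; split => [x /= nx|x [U [BU PU] Ux] /(_ (~` U))].
    have [C [[cC PC] nCx]] : exists C, (closed C /\ P C = 1%E) /\ ~ C x.
      apply: contrapT => /forallNP h; apply: nx => C CP.
      by apply: contrapT => nC; exact: (h C).
    have /nB[U [BU Ux] UC] : nbhs x (~` C).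
      by apply: open_nbhs_nbhs; split => //; exact: closed_openC.
    exists U => //; split => //.
    apply/eqP; rewrite -measure_le0.
    have <- : P (~` C) = 0%E.
      rewrite probability_setC ?PC ?subee//.
      exact: polish_closed_measurable.
    apply: le_measure; rewrite ?inE//.
    - by apply: polish_open_measurable; exact: oB.
    - by apply: measurableC; exact: polish_closed_measurable.
  have mU : measurable U by apply: polish_open_measurable; exact: oB.
  apply=> //; split; first by rewrite closedC; exact: oB.
  by rewrite probability_setC// PU sube0.
have P0 : P (~` supp P) = 0%E.
  have /pcard_surjP[g sg] := cB0.
  (* [g] enumerates a superset of [B0]; its other values are replaced by [set0] *)
  pose F n := if pselect (B0 (g n)) then g n else set0.
  have -> : ~` supp P = \bigcup_n F n.
    rewrite suppE; apply/seteqP; split => [x [U B0U Ux]|x [n _]].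
      by have [n _ gn] := sg U B0U; exists n => //; rewrite /F gn;
        case: pselect => // -[].
    by rewrite /F; case: pselect => // B0g gx; exists (g n).
  have mF n : measurable (F n).
    rewrite /F; case: pselect => [[Bg ?]|?] /=; last exact: measurable0.
    by apply: polish_open_measurable; exact: oB.
  apply: measure_negligible; first exact: bigcupT_measurable.
  apply: negligible_bigcup => n; apply/negligibleP => //.
  by rewrite /F; case: pselect => [[]|?] /=; rewrite ?measure0.
by rewrite -[supp P]setCK probability_setC ?P0 ?sube0//;
  apply: measurableC; exact: measurable_supp.
Qed.

End support.

(** * The marginal risk form *)

Section risk_marginal.
Context (R : realType) (dX dY : measure_display)
  (X : polishType R dX) (Y : polishType R dY).

(** The kernel x |-> dirac at [point].  Any kernel would do below; for this one
    the measurability of [lam |-> tensor lam Q] is immediate. *)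
Definition const_kernel : X -> {measure set Y -> \bar R} :=
  kdirac (@measurable_cst _ _ X Y setT point).

HB.instance Definition _ := ProbabilityKernel.on const_kernel.

Lemma tensor_const_kernelE (lam : probability X R) (A : set (X * Y)) :
  measurable A -> tensor lam const_kernel A = lam (ysection A point).
Proof.
move=> mA; rewrite /tensor.
transitivity (\int[lam]_x (\1_(ysection A point) x)%:E)%E.
  apply: eq_integral => x _.
  rewrite /const_kernel/= /kdirac/= diracE indicE.
  by rewrite mem_xsection mem_ysection.
by rewrite integral_indic ?setIT//; exact: measurable_ysection.
Qed.

Lemma marginal_tensor (lam : probability X R) (Q : R.-pker X ~> Y) (A : set X) :
  measurable A -> marginal (tensor lam Q) A = lam A.
Proof.
move=> mA; rewrite /marginal/= /distribution/= /pushforward/= /tensor.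
transitivity (\int[lam]_x (\1_A x)%:E)%E; last by rewrite integral_indic ?setIT.
apply: eq_integral => x _; rewrite indicE.
have [xA|xA] := boolP (x \in A).
  rewrite (_ : xsection _ _ = setT) ?prob_kernel//.
  by apply/seteqP; split => // y _; rewrite /xsection/= inE/=; exact: set_mem.
rewrite (_ : xsection _ _ = set0) ?measure0//.
apply/seteqP; split => // y; rewrite /xsection/= inE/= => /mem_set xA'.
by rewrite xA' in xA.
Qed.

Lemma tensor_eq (lam lam' : probability X R) (Q : R.-pker X ~> Y)
    (A : set (X * Y)) :
  (forall B, measurable B -> lam B = lam' B) -> measurable A ->
  tensor lam Q A = tensor lam' Q A.
Proof.
move=> ll mA; rewrite /tensor; apply: eq_measure_integral => B mB _; exact: ll.
Qed.

Variable rho : bmfun (X * Y)%type -> probability (X * Y)%type R -> R.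
Hypotheses (frho : risk_form rho) (mrho : monotonic rho)
  (nrho : normalized rho) (trho : translation_equivariant rho)
  (srho : support_property rho) (crho : conditionally_consistent rho).

Lemma risk_cst a P : rho (bm_cst _ a) P = a.
Proof.
rewrite -[RHS]addr0 -(nrho P) -trho; congr (rho _ P).
by apply: bmfunP => x /=; rewrite addr0.
Qed.

(** The support property, for two functions that agree on the support. *)
Lemma risk_eq_on_supp (V W : bmfun (X * Y)%type) P :
  (forall z, supp P z -> V z = W z) -> rho V P = rho W P.
Proof.
move=> VW; rewrite -(srho V) -(srho W); congr (rho _ P).
apply: bmfunP => z /=; rewrite indicE.
have [/set_mem/VW ->//|_] := boolP (z \in supp P); by rewrite !mul0r.
Qed.

Lemma conditional_risk_lift (f : bmfun X) (Q : R.-pker X ~> Y) x :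
  conditional_risk rho (bm_lift Y f) Q x = f x.
Proof.
rewrite /conditional_risk -[RHS](risk_cst (f x) (dirac_tensor x Q)).
apply: risk_eq_on_supp => -[x' y].
have cx : closed ([set x] `*` [set: Y]).
  rewrite (_ : _ `*` _ = fst @^-1` [set x]); last first.
    by apply/seteqP; split => [z [] //|z zx]; split.
  apply: preimage_closed; last exact: polish_closed_set1.
  by move=> z _; exact: cvg_fst.
move/(supp_sub cx); rewrite /=; case; last by move=> /= ->.
rewrite dirac_tensorE; last exact: polish_closed_measurable.
by rewrite in_xsectionX ?prob_kernel// inE.
Qed.

(** The kernels on the two sides may differ: the risk of [Z] under [tensor lam Q]
    depends only on the conditional risk of [Z] and on [lam]. *)
Lemma risk_disintegrated (Z : bmfun (X * Y)%type) (f : bmfun X)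
    (lam : probability X R) (Q Q' : R.-pker X ~> Y) :
  conditional_risk rho Z Q =1 f ->
  rho Z (tensor lam Q) = rho (bm_lift Y f) (tensor lam Q').
Proof.
move=> Zf; apply/le_anti/andP; split; apply: crho => x;
  by rewrite Zf conditional_risk_lift.
Qed.

(** The risk form induced by [rho] on the first factor. *)
Definition marginal_risk (f : bmfun X) (lam : probability X R) : R :=
  rho (bm_lift Y f) (tensor lam const_kernel).

Lemma marginal_risk_form : risk_form marginal_risk.
Proof.
split => [f|lam].
- have mt : measurable_fun [set: pprobability X R]
      (fun lam => tensor lam const_kernel : pprobability (X * Y)%type R).
    apply: (measurability (@pset _ _ _ : set (set (pprobability (X * Y)%type R)))) => //.
    move=> _ [_ [r r01 [A mA <-]] <-]; rewrite setTI.
    apply: sub_sigma_algebra; exists r => //; exists (ysection A point).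
      exact: measurable_ysection.
    by apply/seteqP; split => lam /=; rewrite /mset/= tensor_const_kernelE.
  exact: (measurableT_comp (frho.1 (bm_lift Y f)) mt).
- have ml : measurable_fun [set: g_sigma_algebraType (sup_open X)]
      (fun f => bm_lift Y f : g_sigma_algebraType (sup_open (X * Y)%type)).
    apply: (@measurability _ _ (g_sigma_algebraType (sup_open X))
      (g_sigma_algebraType (sup_open (X * Y)%type)) setT _
      (sup_open (X * Y)%type)) => //.
    move=> _ [U oU <-]; rewrite setTI; apply: sub_sigma_algebra => f /= /oU[e e0 eU].
    by exists e => // g gf; apply: eU => -[x y] /=; exact: gf.
  exact: (measurableT_comp (frho.2 (tensor lam const_kernel)) ml).
Qed.

Lemma marginal_risk_disintegration :
  disintegration_formula frho mrho nrho trho marginal_risk.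
Proof.
move=> Z P Q PQ; rewrite (risk_form_eq_measurable Z frho PQ).
exact: risk_disintegrated.
Qed.

Lemma marginal_formula_unique (r r' : bmfun X -> probability X R -> R) :
  risk_form r -> risk_form r' ->
  marginal_formula rho r -> marginal_formula rho r' -> r' = r.
Proof.
move=> fr fr' mr mr'; apply/funext => f; apply/funext => lam.
have ml A : measurable A -> lam A = marginal (tensor lam const_kernel) A.
  by move=> mA; rewrite marginal_tensor.
rewrite (risk_form_eq_measurable f fr ml) (risk_form_eq_measurable f fr' ml).
by rewrite mr mr'.
Qed.

Section marginal_properties.
Variable r : bmfun X -> probability X R -> R.
Hypotheses (fr : risk_form r) (mr : marginal_formula rho r).

Lemma marginal_formulaE f lam : r f lam = marginal_risk f lam.
Proof.
rewrite /marginal_risk -mr; apply: risk_form_eq_measurable => // A mA.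
by rewrite marginal_tensor.
Qed.

Lemma marginal_monotonic : monotonic r.
Proof.
by move=> f g lam fg; rewrite !marginal_formulaE; apply: mrho => z; exact: fg.
Qed.

Lemma marginal_normalized : normalized r.
Proof.
move=> lam; rewrite marginal_formulaE -[RHS](nrho (tensor lam const_kernel)).
by congr (rho _ _); apply: bmfunP.
Qed.

Lemma marginal_translation_equivariant : translation_equivariant r.
Proof.
move=> f a lam; rewrite !marginal_formulaE -trho.
by congr (rho _ _); apply: bmfunP.
Qed.

Lemma marginal_support_property : support_property r.
Proof.
move=> f lam; rewrite !marginal_formulaE; apply: risk_eq_on_supp => -[x y].
have cx : closed (supp lam `*` [set: Y]).
  rewrite (_ : _ `*` _ = fst @^-1` supp lam); last first.
    by apply/seteqP; split => [z [] //|z zx]; split.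
  apply: preimage_closed; last by apply: closed_bigI => C [].
  by move=> z _; exact: cvg_fst.
move/(supp_sub cx); case => [|/= sx _]; last by rewrite indicE mem_set ?mul1r.
rewrite /= tensor_const_kernelE; last exact: polish_closed_measurable.
rewrite in_ysectionX ?inE//; exact: prob_supp.
Qed.

End marginal_properties.
End risk_marginal.

(** * Coding a sequence of events by one real number *)

Section coding.
Context d (T : measurableType d) (R : realType) (B : (set T)^nat).
Hypothesis mB : forall m, measurable (B m).

(* [s y] is the number whose [m]-th ternary digit is the indicator of [B m] at [y];
   as only 0 and 1 are used, the tail after position [m] is at most half of [w m]. *)
Let w (m : nat) : R := 3^-1 ^+ m.+1.
Let S (n : nat) (y : T) : R := \sum_(i < n) w i * \1_(B i) y.

Let wS m : (3^-1 : R) ^+ m = 3 * w m :> R.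
Proof. by rewrite /w exprS mulrA divff ?mul1r. Qed.

Let w_gt0 m : 0 < w m. Proof. by rewrite exprn_gt0// invr_gt0. Qed.

Let SS n y : S n.+1 y = S n y + w n * \1_(B n) y.
Proof. by rewrite /S big_ord_recr. Qed.

Let S_bound m n y : (m <= n)%N ->
  S m y <= S n y <= S m y + (3^-1 ^+ m - 3^-1 ^+ n) / 2.
Proof.
move=> /subnK <-; elim: (n - m)%N => [|k /andP[h1 h2]].
  by rewrite add0n subrr mul0r addr0 lexx.
rewrite addSn SS.
have : 0 <= w (k + m) * \1_(B (k + m)) y <= w (k + m).
  rewrite indicE; case: (_ \in _); rewrite ?(mulr1, mulr0) ?lexx ltW ?w_gt0//.
move: h2; rewrite (wS (k + m)) -/(w (k + m)).
by move=> ? /andP[? ?]; apply/andP; split; lra.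
Qed.

Let S_nd y : nondecreasing_seq (S ^~ y).
Proof. by move=> m n /(S_bound y)/andP[]. Qed.

Let S_cvg y : cvgn (S ^~ y).
Proof.
apply: nondecreasing_is_cvgn => //; exists (1 / 2) => _ [n _ <-].
have /andP[_] := S_bound y (leq0n n).
rewrite /S big_ord0 add0r expr0 => /le_trans; apply.
by rewrite ler_pM2r// lerBlDr lerDl exprn_ge0.
Qed.

Let s y : R := limn (S ^~ y).

Let s_bound m y : S m y <= s y <= S m y + 3^-1 ^+ m / 2.
Proof.
apply/andP; split; first exact: nondecreasing_cvgn_le.
apply: limr_le => //; exists m => // n /= /(S_bound y)/andP[_ /le_trans]; apply.
by rewrite lerD2l ler_pM2r// lerBlDr lerDl exprn_ge0.
Qed.

(* [t m r] is the number formed by the first [m] digits of [r], found greedily;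
   digit [m] is 1 when [t m r + w m <= r]. *)
Let t := fix t (m : nat) (r : R) : R :=
  if m is m'.+1 then t m' r + (if t m' r + w m' <= r then w m' else 0) else 0.

Let t_coding m y : (t m (s y) + w m <= s y) = (y \in B m) ->
  t m.+1 (s y) = t m (s y) + w m * \1_(B m) y.
Proof. by move=> /= ->; rewrite indicE; case: ifP; rewrite ?mulr1 ?mulr0. Qed.

Let tS m y : t m (s y) = S m y /\ (t m (s y) + w m <= s y) = (y \in B m).
Proof.
have step k : t k (s y) = S k y -> (t k (s y) + w k <= s y) = (y \in B k).
  move=> ->; have /andP[] := s_bound k.+1 y; rewrite SS indicE.
  case: (_ \in _); rewrite ?mulr1 ?mulr0 ?addr0; first by move=> ->.
  move=> _ h; apply/negbTE; rewrite -ltNge; apply: le_lt_trans h _.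
  rewrite ltrD2l -/(w k); have := w_gt0 k; lra.
suff tE : t m (s y) = S m y by split => //; exact: step.
elim: m => [|m IH]; first by rewrite /S big_ord0.
by rewrite t_coding ?SS ?IH//; have := step _ IH; rewrite IH.
Qed.

Let mt m : measurable_fun setT (t m).
Proof.
elim: m => [|m IH] /=; first exact: measurable_cst.
apply: measurable_funD => //; apply: measurable_fun_ifT => //.
by apply: measurable_fun_ler => //; exact: measurable_funD.
Qed.

(** Countably many measurable sets can be pulled back simultaneously from Borel
    sets of the real line by one measurable function. *)
Lemma measurable_coding : exists (s : T -> R) (H : (set R)^nat),
  [/\ measurable_fun setT s, forall m, measurable (H m) &
      forall m, s @^-1` H m = B m].
Proof.
exists s, (fun m => [set r | t m r + w m <= r]); split.
- apply: (measurable_fun_cvg (h := S)) => [n|y _]; last exact: S_cvg.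
  apply: measurable_sum => i; apply: measurable_funM.
    exact: measurable_cst.
  exact: measurable_indic.
- move=> m; rewrite -[X in measurable X]setTI.
  by apply: measurable_fun_ler => //; exact: measurable_funD.
- by move=> m; apply/seteqP; split => y /=; rewrite (tS m y).2 inE.
Qed.

End coding.

(** * Polish spaces are measurable retracts of the real line *)

Section measurable_quantifiers.
Context d (T : measurableType d).

Lemma measurable_prop (P : Prop) : measurable [set _ : T | P].
Proof.
have [p|np] := pselect P.
  by rewrite (_ : [set _ | _] = setT)//; apply/seteqP; split.
by rewrite (_ : [set _ | _] = set0)//; apply/seteqP; split.
Qed.

Lemma measurable_forall_nat (A : nat -> set T) :
  (forall n, measurable (A n)) -> measurable [set x | forall n, A n x].
Proof.
move=> mA; rewrite (_ : [set x | _] = \bigcap_n A n).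
  exact: bigcapT_measurable.
by apply/seteqP; split => [x Ax n _//|x Ax n]; exact: Ax.
Qed.

Lemma measurable_exists_nat (A : nat -> set T) :
  (forall n, measurable (A n)) -> measurable [set x | exists n, A n x].
Proof.
move=> mA; rewrite (_ : [set x | _] = \bigcup_n A n).
  exact: bigcupT_measurable.
by apply/seteqP; split => [x [n]|x [n _]]; exists n.
Qed.

Lemma measurable_imply_set (A B : set T) :
  measurable A -> measurable B -> measurable [set x | A x -> B x].
Proof.
move=> mA mB; rewrite (_ : [set x | _] = ~` A `|` B).
  by apply: measurableU => //; exact: measurableC.
apply/seteqP; split => [x AB|x [nA /nA//|Bx _//]].
by have [/AB|] := pselect (A x); [right|left].
Qed.

End measurable_quantifiers.

Section polish_coding.
Context (R : realType) d (Y : polishType R d).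

(** Only the retraction [p] uses completeness: it has to be defined, and
    measurable, on all of [R], while the range of [s] may be any set. *)
Lemma polish_coding : exists (s : Y -> R) (p : R -> Y),
  [/\ measurable_fun setT s, measurable_fun setT p & cancel s p].
Proof.
have [dist [d0 ds dt dn dc]] := @polish_metrizable R d Y.
have d_ge0 x y : 0 <= dist x y.
  rewrite -(@pmulrn_lge0 _ _ 2)// mulr2n {2}ds -((d0 x x).2 erefl).
  exact: dt.
have [D cD dD] := @polish_separable R d Y.
have /pcard_surjP[c sc] := cD.
pose e (n : nat) : R := n.+1%:R^-1.
have e_gt0 n : 0 < e n by rewrite invr_gt0.
have e_small (r : R) : 0 < r -> exists N, forall n, (N <= n)%N -> e n < r.
  move=> r0; exists (Num.truncn r^-1) => n Nn.
  rewrite /e -[ltRHS]invrK ltf_pV2 ?posrE ?invr_gt0//.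
  by apply: lt_le_trans (truncnS_gt _) _; rewrite ler_nat ltnS.
have obl x r : open [set y | dist x y < r].
  rewrite openE => y /= xy; rewrite /interior dn.
  exists (r - dist x y); first by rewrite /= subr_gt0.
  move=> z /= yz; apply: le_lt_trans (dt _ y _) _.
  by rewrite -ltrBrDl.
(* through the bijection of [nat * nat] with codes, [B] lists the balls of
   radius [e n] around [c k] *)
pose B m := let q := odflt (0, 0)%N (choice.unpickle m) in
  [set y | dist (c q.2) y < e q.1].
have mB m : measurable (B m) by apply: polish_open_measurable; exact: obl.
have [s [H [ms mH sH]]] := @measurable_coding _ _ R B mB.
pose b (n k : nat) := H (choice.pickle (n, k)).
have mb n k : measurable (b n k) by exact: mH.
have sb n k y : b n k (s y) <-> dist (c k) y < e n.
  by rewrite /b -[_ (s y)]/((s @^-1` _) y) sH /B /= choice.pickleK.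
(* [C] is the set of the codes that designate balls of every radius [e n], with
   centres as close to each other as if the balls had a common point; the centres
   then have a limit. *)
pose C := [set r | (forall n, exists k, b n k r) /\
  forall n k n' k', b n k r -> b n' k' r -> dist (c k) (c k') <= e n + e n'].
have mC : measurable C.
  apply: measurableI.
    by apply: measurable_forall_nat => n; exact: measurable_exists_nat.
  do 4 (apply: measurable_forall_nat => ?).
  apply: measurable_imply_set => //; apply: measurable_imply_set => //.
  exact: measurable_prop.
have limC r : exists l, (C r -> forall n k, b n k r -> dist (c k) l <= e n) /\
    (~ C r -> l = point).
  have [[br compat]|] := pselect (C r); last by exists point.
  have [u bu] := choice br.
  have [|l ul] := dc (c \o u).
    move=> eps eps0; have [N eN] := e_small (eps / 2) (divr_gt0 eps0 (ltr0Sn _ 1)).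
    exists N => m n Nm Nn /=; apply: le_lt_trans (compat _ _ _ _ (bu m) (bu n)) _.
    by rewrite (splitr eps) ltrD// eN.
  exists l; split => [_ n k bnk|]; last by move=> /(_ (conj br compat)).
  apply/ler_addgt0Pr => eps eps0.
  have [N eN] := e_small (eps / 2) (divr_gt0 eps0 (ltr0Sn _ 1)).
  have : nbhs l [set y | dist l y < eps / 2].
    by rewrite dn; exists (eps / 2) => //=; exact: divr_gt0.
  move=> /ul[M _ uM].
  pose m := maxn N M.
  have h1 : e m < eps / 2 by apply: eN; exact: leq_maxl.
  have h2 : dist l (c (u m)) < eps / 2 by apply: (uM m); exact: leq_maxr.
  have h3 := compat _ _ _ _ bnk (bu m).
  have h4 := dt (c k) (c (u m)) l.
  rewrite ds in h2; lra.
have [p pP] := choice limC.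
(* membership of the limit in a closed set is a countable condition on the code *)
have mclosed F : closed F -> measurable (p @^-1` F).
  move=> cF.
  have -> : p @^-1` F = (C `&` [set r | forall n, exists k, b n k r /\
        exists z, F z /\ dist (c k) z <= e n]) `|` (~` C `&` [set _ | F point]).
    apply/seteqP; split => r.
      have [Cr Fp|nCr /=] := pselect (C r); last by rewrite ((pP r).2 nCr); right.
      left; split => // n; have [k bk] := Cr.1 n; exists k; split => //.
      by exists (p r); split => //; exact: (pP r).1.
    case => [[Cr Fr]|[nCr /=]]; last by rewrite ((pP r).2 nCr).
    apply: contrapT => /= nF.
    have : nbhs (p r) (~` F).
      by apply: open_nbhs_nbhs; split => //; exact: closed_openC.
    rewrite dn => -[eps /= eps0 epsF].
    have [N eN] := e_small (eps / 2) (divr_gt0 eps0 (ltr0Sn _ 1)).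
    have [k [bk [z [Fz kz]]]] := Fr N.
    apply: (epsF z) => //=.
    have h1 := (pP r).1 Cr _ _ bk.
    have h2 := dt (p r) (c k) z.
    have h3 := eN N (leqnn _).
    by rewrite (ds (p r) (c k)) in h2; lra.
  apply: measurableU; apply: measurableI => //.
  - apply: measurable_forall_nat => n; apply: measurable_exists_nat => k.
    by apply: measurableI => //; exact: measurable_prop.
  - exact: measurableC.
  - exact: measurable_prop.
exists s, p; split => //.
  apply: (@measurability _ _ _ _ setT p (@open Y)); first exact: polish_borel.
  move=> _ [U oU <-]; rewrite setTI.
  have := measurableC (mclosed _ (open_closedC oU)).
  by rewrite preimage_setC setCK.
have Cs y : C (s y).
  split => [n|n k n' k' /sb h1 /sb h2].
    have [x [/= yx Dx]] : [set z | dist y z < e n] `&` D !=set0.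
      by apply: dD => //; exists y; rewrite /= (d0 y y).2.
    have [k _ ckx] := sc x Dx.
    by exists k; apply/sb; rewrite ckx ds.
  have := dt (c k) y (c k'); rewrite (ds y); lra.
move=> y; apply: (d0 _ _).1; apply/le_anti; rewrite d_ge0 andbT.
apply/ler_addgt0Pr => eps eps0; rewrite add0r.
have [N eN] := e_small (eps / 2) (divr_gt0 eps0 (ltr0Sn _ 1)).
have [k bk] := (Cs y).1 N.
have h1 := (pP (s y)).1 (Cs y) _ _ bk.
have h2 := dt (p (s y)) (c k) y.
have h3 := eN N (leqnn _).
move/sb : bk => h4.
by rewrite (ds _ (c k)) in h2; lra.
Qed.

End polish_coding.

(** * Conditional densities *)

(** For a sigma-finite [mu] the hypothesis [fg] says that [f <= g] almost
    everywhere.  What is needed of it, about [mine] and [maxe], holds for every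
    [mu] and follows by splitting along the set where [f x <= g x]. *)
Section min_max_integral.
Local Open Scope ereal_scope.
Context d (T : measurableType d) (R : realType) (mu : {measure set T -> \bar R}).
Variables f g : T -> \bar R.
Hypotheses (mf : measurable_fun setT f) (mg : measurable_fun setT g).
Hypotheses (f0 : forall x, 0 <= f x) (g0 : forall x, 0 <= g x).
Hypothesis fg : forall D, measurable D ->
  \int[mu]_(x in D) f x <= \int[mu]_(x in D) g x.

Let A := [set x | f x <= g x].

Let mA : measurable A.
Proof. by rewrite -[A]setTI; exact: measurable_lee. Qed.

Let integral_split D (h : T -> \bar R) : measurable D ->
  measurable_fun setT h -> (forall x, 0 <= h x) ->
  \int[mu]_(x in D) h x =
  \int[mu]_(x in D `&` A) h x + \int[mu]_(x in D `\` A) h x.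
Proof.
move=> mD mh h0; rewrite -{1}(setUIDK D A) ge0_integral_setU//.
- exact: measurableI.
- exact: measurableD.
- exact: measurable_funTS.
- by apply/disj_setPS => x [[_ Ax] [_ /(_ Ax)]].
Qed.

Lemma integral_mine D : measurable D ->
  \int[mu]_(x in D) mine (f x) (g x) = \int[mu]_(x in D) f x.
Proof.
move=> mD; have mm := measurable_mine mf mg.
have m0 x : 0 <= mine (f x) (g x) by rewrite le_min f0 g0.
have mDA := measurableD mD mA.
apply/le_anti/andP; split.
  apply: ge0_le_integral => //; [exact: measurable_funTS..|].
  by move=> x _; rewrite ge_min lexx.
rewrite integral_split// [leRHS]integral_split//; apply: leeD.
  rewrite le_eqVlt; apply/orP; left; apply/eqP.
  by apply: eq_integral => x /set_mem[_ fgx]; rewrite min_l.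
apply: le_trans (fg mDA) _; rewrite le_eqVlt; apply/orP; left; apply/eqP.
apply: eq_integral => x /set_mem[_ /negP]; rewrite -ltNge => /ltW gfx.
by rewrite min_r.
Qed.

Lemma integral_maxe D : measurable D ->
  \int[mu]_(x in D) maxe (f x) (g x) = \int[mu]_(x in D) g x.
Proof.
move=> mD; have mm := measurable_maxe mf mg.
have m0 x : 0 <= maxe (f x) (g x) by rewrite le_max f0.
have mDA := measurableD mD mA.
apply/le_anti/andP; split; last first.
  apply: ge0_le_integral => //; [exact: measurable_funTS..|].
  by move=> x _; rewrite le_max lexx orbT.
rewrite integral_split// [leRHS]integral_split//; apply: leeD.
  rewrite le_eqVlt; apply/orP; left; apply/eqP.
  by apply: eq_integral => x /set_mem[_ fgx]; rewrite max_r.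
apply: le_trans _ (fg mDA); rewrite le_eqVlt; apply/orP; left; apply/eqP.
apply: eq_integral => x /set_mem[_ /negP]; rewrite -ltNge => /ltW gfx.
by rewrite max_l.
Qed.

End min_max_integral.

Section conditional_density.
Local Open Scope ereal_scope.
Context (R : realType) dX dZ (X : measurableType dX) (Z : measurableType dZ).
Variables (P : probability (X * Z)%type R) (lam : probability X R).
Hypothesis PX : forall D, measurable D -> lam D = P (D `*` setT).

(** [f] is a version, with values in [0, 1], of the conditional probability that
    the second coordinate lies in [B], given the first one. *)
Definition conditional_density (B : set Z) (f : X -> \bar R) :=
  [/\ measurable_fun setT f, forall x, 0 <= f x <= 1 &
      forall D, measurable D -> \int[lam]_(x in D) f x = P (D `*` B)].

Section slice.
Variable B : set Z.

(** The measure [D |-> P (D `*` B)] on [X].  The proof that [B] is measurable is an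
    argument so that the measure structure can be inferred from the term. *)
Definition slice of measurable B := fun D : set X => P (D `*` B).

Hypothesis mB : measurable B.

Let slice0 : slice mB set0 = 0.
Proof. by rewrite /slice set0X measure0. Qed.

Let slice_ge0 D : 0 <= slice mB D.
Proof. exact: measure_ge0. Qed.

Let slice_sigma_additive : semi_sigma_additive (slice mB).
Proof.
move=> F mF tF mUF; rewrite /slice setX_bigcupl.
apply: measure_semi_sigma_additive.
- by move=> n; exact: measurableX.
- apply/trivIsetP => i j _ _ ij; apply/seteqP; split => // -[x z] [[/= Fi _] [/= Fj _]].
  suff: (F i `&` F j) x by move/trivIsetP : tF => ->.
  by split.
- by rewrite -setX_bigcupl; exact: measurableX.
Qed.

HB.instance Definition _ := isMeasure.Build _ X R (slice mB)
  slice0 slice_ge0 slice_sigma_additive.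

Let slice_finite : fin_num_fun (slice mB).
Proof. by move=> D mD; apply: fin_num_measure; exact: measurableX. Qed.

HB.instance Definition _ := @Measure_isFinite.Build _ X R (slice mB)
  slice_finite.

End slice.

Lemma conditional_density_exists (B : set Z) : measurable B ->
  exists f, conditional_density B f.
Proof.
move=> mB; have PXB D : measurable D -> P (D `*` B) <= lam D.
  move=> mD; rewrite PX//; apply: le_measure; rewrite ?inE.
  - exact: measurableX.
  - exact: measurableX.
  - by move=> z [].
have slice_lam : slice mB `<< lam.
  apply/null_content_dominatesP => D mD lD.
  by apply/eqP; rewrite -measure_le0 -lD; exact: PXB.
have [f [f0 _ /integrableP[mf _] fE]] := radon_nikodym_sigma_finite slice_lam.
have f1 D : measurable D -> \int[lam]_(x in D) f x <= \int[lam]_(x in D) cst 1 x.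
  by move=> mD; rewrite -fE// integral_cst// mul1e; exact: PXB.
exists (fun x => mine (f x) 1); split.
- exact: measurable_mine.
- by move=> x; rewrite le_min f0 lee01 ge_min lexx orbT.
- by move=> D mD; rewrite (integral_mine mf _ _ _ f1)// -fE.
Qed.

Lemma conditional_density_set0 : conditional_density set0 (cst 0).
Proof.
by split => [|x|D mD]; rewrite ?lexx ?lee01// integral0 setX0 measure0.
Qed.

Lemma conditional_density_max (B B' : set Z) f f' :
  measurable B -> measurable B' ->
  B `<=` B' -> conditional_density B f -> conditional_density B' f' ->
  conditional_density B' (fun x => maxe (f x) (f' x)).
Proof.
move=> mB mB' BB' [mf f01 fE] [mf' f'01 f'E].
have f0 x : 0 <= f x by have /andP[] := f01 x.
have f'0 x : 0 <= f' x by have /andP[] := f'01 x.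
split.
- exact: measurable_maxe.
- move=> x; rewrite le_max f0/= ge_max.
  by have /andP[_ ->] := f01 x; have /andP[_ ->] := f'01 x.
- move=> D mD; rewrite integral_maxe// ?f'E// => {D mD} D mD.
  rewrite fE// f'E//; apply: le_measure; rewrite ?inE.
  - exact: measurableX.
  - exact: measurableX.
  - by move=> z [? /BB'].
Qed.

(** Chains only: the partial maxima are densities of the partial unions, because
    each partial union is a member of the chain; then monotone convergence. *)
Lemma conditional_density_bigcup (B : (set Z)^nat) (f : (X -> \bar R)^nat) :
  (forall i, measurable (B i)) ->
  (forall i j, B i `<=` B j \/ B j `<=` B i) ->
  (forall i, conditional_density (B i) (f i)) ->
  conditional_density (\bigcup_i B i) (fun x => ereal_sup (range (f ^~ x))).
Proof.
move=> mB chB fB.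
pose M := fix M n x := if n is n'.+1 then maxe (M n' x) (f n x) else f 0%N x.
pose V n := \bigcup_(i in `I_n.+1) B i.
have VS n : V n.+1 = V n `|` B n.+1.
  by rewrite /V !bigcup_mkord big_ord_recr.
have VB n : exists i, V n = B i.
  elim: n => [|n [i Vi]].
    by exists 0%N; rewrite /V bigcup_mkord big_ord_recr/= big_ord0 set0U.
  rewrite VS Vi; have [ij|ji] := chB i n.+1.
    by exists n.+1; exact: (setUidPr _ _).2.
  by exists i; exact: (setUidPl _ _).2.
have mV n : measurable (V n) by have [i ->] := VB n.
have VM n : conditional_density (V n) (M n).
  elim: n => [|n IH]; first by rewrite /V bigcup_mkord big_ord_recr/= big_ord0 set0U.
  rewrite VS; have [i Vi] := VB n; have [ij|ji] := chB i n.+1.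
    rewrite Vi ((setUidPr _ _).2 ij); apply: conditional_density_max ij _ _ => //.
    by rewrite -Vi.
  rewrite Vi ((setUidPl _ _).2 ji).
  have := conditional_density_max (mB n.+1) (mB i) ji (fB n.+1).
  rewrite -Vi => /(_ _ IH); congr conditional_density.
  by apply/funext => x /=; rewrite maxC.
have fM n x : f n x <= M n x.
  by case: n => [|n] //=; rewrite le_max lexx orbT.
have ndM x : nondecreasing_seq (M ^~ x).
  by apply/nondecreasing_seqP => n /=; rewrite le_max lexx.
have Mf n x : M n x <= ereal_sup (range (f ^~ x)).
  elim: n => [|n IH]; first by apply: ereal_sup_ubound; exists 0%N.
  by rewrite /= ge_max IH; apply: ereal_sup_ubound; exists n.+1.
have supE x : ereal_sup (range (f ^~ x)) = ereal_sup (range (M ^~ x)).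
  apply/le_anti/andP; split; apply: ge_ereal_sup => _ [n _ <-] //.
  by apply: le_trans (fM n x) _; apply: ereal_sup_ubound; exists n.
have cvgM x : M ^~ x @ \oo --> ereal_sup (range (f ^~ x)).
  by rewrite supE; exact: ereal_nondecreasing_cvgn.
have mM n : measurable_fun setT (M n) by have [] := VM n.
have M0 n x : 0 <= M n x by have [_ /(_ x)/andP[]] := VM n.
split.
- by apply: emeasurable_fun_cvg mM _ => x _; exact: cvgM.
- move=> x; rewrite (le_trans (M0 0%N x) (Mf 0%N x))/=.
  by apply: ge_ereal_sup => _ [n _ <-]; have [_ /(_ x)/andP[]] := fB n.
- move=> D mD.
  have : (\int[lam]_(x in D) M n x) @[n --> \oo] -->
      \int[lam]_(x in D) ereal_sup (range (f ^~ x)).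
    under [X in _ --> X]eq_integral do rewrite -(cvg_lim _ (cvgM _))//.
    by apply: cvg_monotone_convergence => // n; exact: measurable_funTS.
  have -> : (fun n => \int[lam]_(x in D) M n x) = P \o (fun n => D `*` V n).
    by apply/funext => n /=; have [_ _ ->] := VM n.
  move=> cvgI; apply: (cvg_unique _ cvgI); first exact: ereal_hausdorff.
  rewrite (_ : \bigcup_i B i = \bigcup_i V i).
    rewrite setX_bigcupr; apply: nondecreasing_cvg_mu.
    - by move=> n; exact: measurableX.
    - by apply: bigcupT_measurable => n; exact: measurableX.
    - apply/nondecreasing_seqP => n; rewrite subsetEset VS.
      by move=> z [? ?]; split => //; left.
  apply/seteqP; split => z [i].
    by move=> _ Bi; exists i => //; exists i => /=.
  by move=> _ [j _ Bj]; exists j.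
Qed.

End conditional_density.

(** * Disintegration *)

Section kernel_map.
Local Open Scope ereal_scope.
Context d d' d'' (X : measurableType d) (Z : measurableType d')
  (Y : measurableType d'') (R : realType).
Variables (K : R.-pker X ~> Z) (phi : X * Z -> Y).

Hypothesis mphi : measurable_fun setT phi.

(** The law of [phi (x, z)] when [z] has law [K x]. *)
Definition kernel_map_measure of measurable_fun setT phi :=
  fun (x : X) (B : set Y) => K x [set z | B (phi (x, z))].

Let preimageE x B : [set z | B (phi (x, z))] = xsection (phi @^-1` B) x.
Proof. by apply/seteqP; split => z; rewrite /xsection/= inE. Qed.

Let mpreimage B : measurable B -> measurable (phi @^-1` B).
Proof. by move=> mB; rewrite -[X in measurable X]setTI; exact: mphi. Qed.

Let msection x B : measurable B -> measurable [set z | B (phi (x, z))].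
Proof.
by move=> mB; rewrite preimageE; apply: measurable_xsection; exact: mpreimage.
Qed.

Let km0 x : kernel_map_measure mphi x set0 = 0.
Proof. by rewrite /kernel_map_measure (_ : [set z | _] = set0)// measure0. Qed.

Let km_ge0 x B : 0 <= kernel_map_measure mphi x B.
Proof. exact: measure_ge0. Qed.

Let km_sigma_additive x : semi_sigma_additive (kernel_map_measure mphi x).
Proof.
move=> F mF tF mUF; rewrite /kernel_map_measure.
rewrite (_ : [set z | _] = \bigcup_n [set z | F n (phi (x, z))])//.
apply: measure_semi_sigma_additive.
- by move=> n; exact: msection.
- apply/trivIsetP => i j _ _ ij; apply/seteqP; split => // z [/= Fi Fj].
  suff: (F i `&` F j) (phi (x, z)) by move/trivIsetP : tF => ->.
  by split.
- exact: (msection x mUF).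
Qed.

HB.instance Definition _ x := isMeasure.Build _ Y R (kernel_map_measure mphi x)
  (km0 x) (@km_ge0 x) (@km_sigma_additive x).

(** The kernel formed by the measures above. *)
Definition kernel_map : X -> {measure set Y -> \bar R} :=
  fun x => kernel_map_measure mphi x.

Let measurable_kernel_map B : measurable B ->
  measurable_fun setT (kernel_map ^~ B).
Proof.
move=> mB; rewrite /kernel_map/=.
rewrite (_ : (fun x => _) = (fun x => K x (xsection (phi @^-1` B) x))).
  by apply: measurable_fun_xsection_finite_kernel; rewrite inE; exact: mpreimage.
by apply/funext => x; rewrite -preimageE.
Qed.

HB.instance Definition _ :=
  isKernel.Build _ _ _ _ _ kernel_map measurable_kernel_map.

Let kernel_map_setT x : kernel_map x [set: Y] = 1.
Proof.
by rewrite /kernel_map/= /kernel_map_measure (_ : [set z | _] = setT) ?prob_kernel.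
Qed.

HB.instance Definition _ :=
  Kernel_isProbability.Build _ _ _ _ _ kernel_map kernel_map_setT.

End kernel_map.

Section disintegration.
Local Open Scope ereal_scope.
Context (R : realType).

Lemma uniform_prob_lt (h : \bar R) : 0 <= h <= 1 ->
  uniform_prob (@ltr01 R) [set u | u%:E < h] = h.
Proof.
case: h => [c||] /andP[]; rewrite ?leye_eq ?leeNy_eq// !lee_fin => c0 c1.
rewrite /uniform_prob integral_uniform_pdf.
rewrite (_ : _ `&` _ = `[0%R, c[%classic); last first.
  apply/seteqP; split => u /=; rewrite !in_itv/= lte_fin.
    by move=> [-> /andP[->]].
  by move=> /andP[u0 uc]; rewrite u0 uc (le_trans (ltW uc)).
rewrite (eq_integral (cst 1)); last first.
  move=> u; rewrite inE/= in_itv/= => /andP[u0 uc].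
  by rewrite /uniform_pdf u0 (le_trans (ltW uc))// subr0 invr1.
rewrite integral_cst//= mul1e lebesgue_measure_itv/= lte_fin sube0.
by case: ltgtP c0 => // <-.
Qed.

(** Rectangles with one side [setT] or [`]-oo, r[] form a pi-system that generates
    the product sigma-algebra. *)
Lemma probability_prod_ereal_unique dX (X : measurableType dX)
    (m1 m2 : probability (X * \bar R)%type R) :
  (forall D, measurable D -> m1 (D `*` setT) = m2 (D `*` setT)) ->
  (forall D r, measurable D ->
    m1 (D `*` `]-oo, r%:E[) = m2 (D `*` `]-oo, r%:E[)) ->
  forall A, measurable A -> m1 A = m2 A.
Proof.
move=> mT mr.
(* the full line is included because +oo lies in no set ]-oo, r[ *)
pose H := [set B : set (\bar R) | B = setT \/ exists r, B = `]-oo, r%:E[%classic].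
pose G := [set D `*` B | D in @measurable _ X & B in H].
have mH B : H B -> measurable B.
  by case=> [->//|[r ->]]; exact: emeasurable_itv.
have HI B C : H B -> H C -> H (B `&` C).
  case=> [->|[r ->]]; first by rewrite setTI.
  case=> [->|[r' ->]]; first by rewrite setIT; right; exists r.
  right; exists (Num.min r r'); apply/seteqP; split => z /=; rewrite !in_itv/=.
    by move=> [zr zr']; rewrite EFin_min lt_min zr.
  by rewrite EFin_min lt_min => /andP[].
have GI : setI_closed G.
  move=> _ _ [D mD [B HB <-]] [D' mD' [B' HB' <-]]; rewrite -setXI.
  by exists (D `&` D'); [exact: measurableI|exists (B `&` B') => //; exact: HI].
have GT : G setT by exists setT => //; exists setT; [left|rewrite setXTT].
have mG : @measurable _ (X * \bar R)%type = <<s G >>.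
  rewrite measurable_prod_measurableType; apply/seteqP; split.
  - apply: smallest_sub; first exact: smallest_sigma_algebra.
    move=> _ [D mD [B mB <-]].
    have sG : sigma_algebra setT (<<s G >>) := smallest_sigma_algebra setT G.
    have [s0 sC sU] := sG.
    have DT : <<s G >> (D `*` setT).
      by apply: sub_sigma_algebra; exists D => //; exists setT => //; left.
    move: mB; rewrite [X in X B -> _](ErealGenInftyO.measurableE R).
    move: B; apply: smallest_sub.
      split => /=.
      - by rewrite setX0.
      - move=> B sB; rewrite (_ : _ `*` _ = (D `*` setT) `\` (D `*` B)).
          exact: (@measurableD _ (g_sigma_algebraType G)).
        apply/seteqP; split => z [].
          by move=> Dz [_ nB]; split => // -[].
        by move=> [Dz _] nDB; split => //; split => // Bz; apply: nDB.
      - by move=> F sF; rewrite setX_bigcupr; exact: sU.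
    move=> _ [r ->]; apply: sub_sigma_algebra; exists D => //.
    by exists `]-oo, r%:E[%classic => //; right; exists r.
  - apply: smallest_sub; first exact: smallest_sigma_algebra.
    move=> _ [D mD [B /mH mB <-]]; apply: sub_sigma_algebra.
    by exists D => //; exists B.
apply: (measure_unique G (fun _ => setT)) => //.
- by rewrite bigcup_const//; exists 0%N.
- by move=> _ [D mD [B [->|[r ->]] <-]]; [exact: mT|exact: mr].
- by move=> _ /=; rewrite probability_setT ltry.
Qed.

Lemma tensor_setX dX dZ (X : measurableType dX) (Z : measurableType dZ)
    (lam : probability X R) (K : R.-pker X ~> Z) (D : set X) (B : set Z) :
  measurable D -> measurable B ->
  tensor lam K (D `*` B) = \int[lam]_(x in D) K x B.
Proof.
move=> mD mB; rewrite /tensor [RHS]integral_mkcond; apply: eq_integral => x _.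
rewrite patchE; case: ifPn => xD; first by rewrite in_xsectionX.
by rewrite notin_xsectionX// measure0.
Qed.

(** The conditional law of [s] given the first coordinate.  It lives on [\bar R],
    so that no care is needed where the infimum defining [G] is infinite, which
    happens only on a null set. *)
Lemma disintegration_real dX dZ (X : measurableType dX) (Z : measurableType dZ)
    (P : probability (X * Z)%type R) (lam : probability X R) (s : Z -> R) :
  (forall D, measurable D -> lam D = P (D `*` setT)) ->
  measurable_fun setT s ->
  exists K : R.-pker X ~> \bar R, forall A, measurable A ->
    tensor lam K A = P [set z | A (z.1, (s z.2)%:E)].
Proof.
move=> PX ms.
have mslt r : measurable [set z | (s z < r)%R].
  rewrite -[X in measurable X]setTI -preimage_itvNyo.
  exact: ms.
have [f fP] := choice (fun q : rat =>
  conditional_density_exists PX (mslt (ratr q))).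
pose q (i : nat) : rat := odflt 0%R (choice.unpickle i).
pose h i (w : X * measurableTypeR R) : \bar R :=
  if w.2%:E < f (q i) w.1 then (ratr (q i))%:E else +oo.
have mh i : measurable_fun setT (h i).
  have [mf _ _] := fP (q i).
  apply: measurable_fun_ifT => //; apply: measurable_fun_lte.
    by apply/measurable_EFinP; exact: measurable_snd.
  exact: measurableT_comp measurable_fst.
(* [G (x, u)] is the infimum of the rationals [q] with [u < f q x] *)
pose G w := einfs (h ^~ w) 0%N.
have mG : measurable_fun setT G by exact: measurable_fun_einfs.
have Glt x u r : G (x, u) < r%:E <->
    exists i, (ratr (q i) < r)%R /\ u%:E < f (q i) x.
  split => [/ereal_inf_lt[_ [i _ <-]]|[i [qr uf]]].
    by rewrite /h /=; case: ifPn => // uf; rewrite lte_fin => qr; exists i.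
  apply: le_lt_trans (_ : h i (x, u) < _).
    by apply: ereal_inf_lbound; exists i.
  by rewrite /h /= uf lte_fin.
pose U0 : probability _ R := uniform_prob (@ltr01 R).
pose U : pprobability (measurableTypeR R) R := U0.
pose K0 : R.-pker X ~> measurableTypeR R := kprobability (@measurable_cst _ _ X _ setT U).
pose K : R.-pker X ~> \bar R := kernel_map K0 mG.
exists K => A mA.
have msZ : measurable_fun setT (fun z : X * Z => (z.1, (s z.2)%:E)).
  apply/measurable_fun_pairP; split; first exact: measurable_fst.
  rewrite /comp /=.
  apply/measurable_EFinP; exact: (measurableT_comp ms).
pose gs : {mfun (X * Z)%type >-> (X * \bar R)%type} :=
  HB.pack (fun z : X * Z => (z.1, (s z.2)%:E)) (isMeasurableFun.Build _ _ _ _ _ msZ).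
rewrite -[RHS]/(distribution P gs A).
move: A mA; apply: probability_prod_ereal_unique => [D mD|D r mD].
  transitivity (lam D).
    rewrite [LHS]tensor_setX//; under eq_integral do rewrite prob_kernel.
    by rewrite integral_cst// mul1e.
  rewrite PX// -[RHS]/(P (gs @^-1` (D `*` setT))).
have qE (a b : R) : (a < b)%R -> exists i, (a < ratr (q i) < b)%R.
  move=> /rat_in_itvoo[p pab]; exists (choice.pickle p).
  by rewrite /q choice.pickleK; move: pab; rewrite in_itv.
pose B i := if (ratr (q i) < r)%R then [set z | (s z < ratr (q i))%R] else set0.
pose g i x := if (ratr (q i) < r)%R then f (q i) x else 0.
have gB i : conditional_density P lam (B i) (g i).
  by rewrite /B /g; case: ifP => // _; exact: conditional_density_set0.
have mB i : measurable (B i) by rewrite /B; case: ifP.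
have chB i j : B i `<=` B j \/ B j `<=` B i.
  rewrite /B; case: ifP => _; last by left.
  case: ifP => _; last by right.
  have [ij|/ltW ji] := leP (ratr (q i) : R) (ratr (q j)); [left|right] => z /= zq.
    exact: lt_le_trans ij.
  exact: lt_le_trans ji.
have [_ sup01 supE] := conditional_density_bigcup mB chB gB.
rewrite [LHS]tensor_setX//; last exact: emeasurable_itv.
transitivity (\int[lam]_(x in D) ereal_sup (range (g ^~ x))).
  apply: eq_integral => x _; rewrite -[RHS]uniform_prob_lt//.
  rewrite /K /= /kernel_map /= /kernel_map_measure /=; congr (uniform_prob _ _).
  apply/seteqP; split => u /=; rewrite in_itv/=.
    move=> /Glt[i [qr uf]]; apply: lt_le_trans uf _.
    by apply: ereal_sup_ubound; exists i => //; rewrite /g qr.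
  move=> /ereal_sup_gt[_ [i _ <-]]; rewrite /g; case: ifP => [qr uf|_ u0].
    by apply/Glt; exists i.
  (* the zero values of [g] are harmless: if [u < 0] then [u < f q x] for all [q] *)
  have [j /andP[_ jr]] := qE (r - 1)%R r (ltac:(by rewrite ltrBlDr ltrDl)).
  apply/Glt; exists j; split => //; apply: lt_le_trans u0 _.
  by have [_ /(_ x)/andP[]] := fP (q j).
rewrite supE// -[RHS]/(P (gs @^-1` (D `*` `]-oo, r%:E[))); congr (P _).
apply/seteqP; split => -[x z] /=.
  move=> [Dx [i _]]; rewrite /B; case: ifP => // qr /= sq; split => //.
  by rewrite in_itv/= lte_fin (lt_trans sq).
move=> [Dx]; rewrite in_itv/= lte_fin => /qE[i /andP[si ir]]; split => //.
by exists i => //; rewrite /B ir.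
Qed.

End disintegration.

Section polish_disintegration.
Context (R : realType) dX dY (X : polishType R dX) (Y : polishType R dY).

(** Given the law of (x, s y), a point of [Y] is recovered by the retraction. *)
Lemma disintegration_exists (P : probability (X * Y)%type R) :
  exists Q : R.-pker X ~> Y, disintegrates P Q.
Proof.
have [s [p [ms mp sp]]] := polish_coding Y.
have [|K KE] := @disintegration_real R _ _ _ _ P (marginal P) s _ ms.
  move=> D mD; congr (P _).
  by apply/seteqP; split => [z|z []].
have mphi : measurable_fun setT (fun w : X * \bar R => p (fine w.2)).
  apply: (measurableT_comp mp).
  exact: (measurableT_comp (fine_measurable measurableT) measurable_snd).
exists (kernel_map K mphi) => A mA.
have mpair : measurable_fun setT (fun w : X * \bar R => (w.1, p (fine w.2))).
  by apply/measurable_fun_pairP; split; [exact: measurable_fst|exact: mphi].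
set A' := (fun w : X * \bar R => (w.1, p (fine w.2))) @^-1` A.
have mA' : measurable A' by rewrite -[X in measurable X]setTI; exact: mpair.
have {1}-> : A = [set z | A' (z.1, (s z.2)%:E)].
  by apply/seteqP; split => -[x y]; rewrite /A'/= sp.
by rewrite -KE.
Qed.

End polish_disintegration.

Theorem theorem4p3 (R : realType) (dX dY : measure_display)
    (X : polishType R dX) (Y : polishType R dY)
    (rho : bmfun (X * Y)%type -> probability (X * Y)%type R -> R)
    (frho : risk_form rho) (mrho : monotonic rho) (nrho : normalized rho)
    (trho : translation_equivariant rho) (srho : support_property rho)
    (crho : conditionally_consistent rho) :
  (exists rhoX : bmfun X -> probability X R -> R,
      risk_form rhoX /\ disintegration_formula frho mrho nrho trho rhoX) /\
  (forall rhoX : bmfun X -> probability X R -> R,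
      risk_form rhoX -> disintegration_formula frho mrho nrho trho rhoX ->
      [/\ marginal_formula rho rhoX /\
          (forall rhoX' : bmfun X -> probability X R -> R,
              risk_form rhoX' -> marginal_formula rho rhoX' -> rhoX' = rhoX),
          monotonic rhoX, normalized rhoX, translation_equivariant rhoX &
          support_property rhoX]).
Proof.
split.
  exists (marginal_risk rho); split; first exact: marginal_risk_form.
  exact: marginal_risk_disintegration.
move=> rhoX frhoX disX.
have margX : marginal_formula rho rhoX.
  move=> f P; have [Q PQ] := disintegration_exists P.
  rewrite (disX _ _ _ PQ); congr rhoX.
  by apply: bmfunP => x /=; rewrite conditional_risk_lift.
split.
- split=> // rhoX' frhoX' margX'; exact: (marginal_formula_unique frhoX frhoX').
- exact: marginal_monotonic margX.
- exact: marginal_normalized margX.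
- exact: marginal_translation_equivariant margX.
- exact: marginal_support_property margX.
Qed.
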